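(* Let $\mathbb K$ be a commutative field, $k\ge1$, $F_k=\langle g_1,\dots,g_k\rangle$ the free group on $k$ generators, and $\mu:F_k\to S\mathbb K\langle\!\langle X_1,\dots,X_k\rangle\!\rangle_{rat}^*$ the homomorphism with $\mu(g_j)=1+X_j$ for $j=1,\dots,k$. Let $g=g_{i_1}^{\alpha_1}\cdots g_{i_m}^{\alpha_m}\in F_k$ be a reduced word, i.e. $i_j\neq i_{j+1}$ for $1\le j<m$ and $\alpha_1,\dots,\alpha_m\in\mathbb Z\setminus\{0\}$. Then $$\|\mu(g)\|=-c+\sum_{j=1}^m|\alpha_j|,\qquad c=\sharp\{1\le j<m\ :\ \alpha_j>0,\ \alpha_{j+1}<0\}.$$ Otherwise stated, $\|\mu(g)\|$ equals the word length of $g\in F_k$ with respect to the symmetric generating set $\{g_1^{\pm1},\dots,g_k^{\pm1}\}\cup\{g_ig_j^{-1} : 1\le i,j\le k,\ i\neq j\}$.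
   Context: For a finite set $\mathcal X$ (here $\mathcal X=\{X_1,\dots,X_k\}$), $\mathcal X^*$ is the free monoid on $\mathcal X$. $\mathbb K\langle\!\langle\mathcal X\rangle\!\rangle$ is the algebra of non-commutative formal power series $A=\sum_{\mathbf X\in\mathcal X^*}(A,\mathbf X)\mathbf X$ with the convolution product. Such a series is invertible iff its constant coefficient $\epsilon(A)=(A,\mathbf 1)$ is non-zero. $\mathbb K\langle\!\langle\mathcal X\rangle\!\rangle_{rat}$ is the smallest subalgebra containing $\mathcal X$ and closed under inversion of those of its elements that are invertible in $\mathbb K\langle\!\langle\mathcal X\rangle\!\rangle$. $S\mathbb K\langle\!\langle\mathcal X\rangle\!\rangle_{rat}^*$ is the multiplicative group of rational series with $\epsilon(A)=1$. For $\mathbf T\in\mathcal X^*$ put $\rho(\mathbf T)A=\sum_{\mathbf X\in\mathcal X^*}(A,\mathbf X\mathbf T)\mathbf X$, and let $\overline A$ be the linear span of $\{\rho(\mathbf T)A:\mathbf T\in\mathcal X^*\}$ (finite-dimensional for rational $A$). For $A\in S\mathbb K\langle\!\langle\mathcal X\rangle\!\rangle_{rat}^*$ set $\|A\|=\dim(\overline A+\mathbb K)-1$, where $\mathbb K$ is the space of constant series. *)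

(* Defs.v *)
From HB Require Import structures.
From mathcomp Require Import all_boot all_order all_algebra.
From mathcomp Require Import boolp classical_sets.

Set Implicit Arguments.
Unset Strict Implicit.
Unset Printing Implicit Defensive.

Import Order.TTheory GRing.Theory Num.Theory.

Section Dimension.
Local Open Scope ring_scope.
Local Open Scope classical_set_scope.
Variables (K : fieldType) (V : lmodType K).
Implicit Types U W : set V.

Definition lspan U : set V :=
  [set v | exists n (c : 'I_n -> K) (s : 'I_n -> V),
     (forall i, U (s i)) /\ v = \sum_(i < n) c i *: s i].

Definition sumspace U W : set V := [set u + w | u in U & w in W].

Definition has_dim U (d : nat) : Prop :=
  exists b : 'I_d -> V,
    (forall c : 'I_d -> K, \sum_(i < d) c i *: b i = 0 -> forall i, c i = 0) /\
    U = [set v | exists c : 'I_d -> K, v = \sum_(i < d) c i *: b i].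

(* The junk value 0 would make [norm] below equal to -1, so an equation
   [norm a = n] with [n >= 0] entails that the space is finite-dimensional. *)
Definition dim U : nat := xget 0%N (has_dim U).

Lemma has_dim_leq U d d' : has_dim U d -> has_dim U d' -> (d <= d')%N.
Proof.
move=> [b [bfree UE]] [b' [_ UE']].
have /choice[M ME] i : exists c : 'I_d' -> K, b i = \sum_(j < d') c j *: b' j.
  suff: U (b i) by rewrite UE'.
  rewrite UE; exists (fun j => (j == i)%:R).
  rewrite (bigD1 i) //= eqxx scale1r big1 ?addr0 // => j /negPf ->.
  by rewrite scale0r.
pose A : 'M[K]_(d, d') := \matrix_(i, j) M i j.
suff: row_free A by move/eqP <-; exact: rank_leq_col.
rewrite -kermx_eq0; apply/eqP/row_matrixP => i; rewrite row0.
have kA : row i (kermx A) *m A = 0 by apply/sub_kermxP; exact: row_sub.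
apply/rowP => j; rewrite [RHS]mxE.
apply: (bfree (fun j => row i (kermx A) 0 j)).
under eq_bigr => l _ do rewrite ME scaler_sumr.
rewrite exchange_big big1 //= => l _.
under eq_bigr => p _ do rewrite scalerA.
rewrite -scaler_suml.
have /rowP/(_ l) := kA; rewrite [X in X = _]mxE [X in _ = X]mxE => kAl.
suff -> : \sum_p row i (kermx A) 0 p * M p l = 0 by rewrite scale0r.
by rewrite -[RHS]kAl; apply: eq_bigr => p _; rewrite [A p l]mxE.
Qed.

Lemma dimE U d : has_dim U d -> dim U = d.
Proof.
move=> Ud; apply: xget_unique => // e Ue.
by apply/eqP; rewrite eqn_leq (has_dim_leq Ue Ud) (has_dim_leq Ud Ue).
Qed.

End Dimension.

Record series (K : fieldType) (X : finType) :=
  Series { coef :> seq X -> K }.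

HB.instance Definition _ K X := gen_eqMixin (series K X).
HB.instance Definition _ K X := gen_choiceMixin (series K X).

Section Series.
Local Open Scope ring_scope.
Variables (K : fieldType) (X : finType).
Local Notation S := (series K X).
Implicit Types (A B C : S) (w T : seq X) (x : X).

Lemma seriesP A B : (forall w, A w = B w) <-> A = B.
Proof.
split=> [eqAB|-> //]; case: A B eqAB => a [b] /= eqab.
by congr Series; apply/funext.
Qed.

Definition series_zero : S := Series (fun=> 0).
Definition series_opp A : S := Series (fun w => - A w).
Definition series_add A B : S := Series (fun w => A w + B w).
Definition series_scale (c : K) A : S := Series (fun w => c * A w).
Definition series_one : S := Series (fun w => (w == [::])%:R).
Definition series_mul A B : S :=
  Series (fun w => \sum_(i < (size w).+1) A (take i w) * B (drop i w)).

Fact series_addA : associative series_add.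
Proof. by move=> A B C; apply/seriesP => w /=; rewrite addrA. Qed.
Fact series_addC : commutative series_add.
Proof. by move=> A B; apply/seriesP => w /=; rewrite addrC. Qed.
Fact series_add0 : left_id series_zero series_add.
Proof. by move=> A; apply/seriesP => w /=; rewrite add0r. Qed.
Fact series_addN : left_inverse series_zero series_opp series_add.
Proof. by move=> A; apply/seriesP => w /=; rewrite addNr. Qed.

HB.instance Definition _ := GRing.isZmodule.Build S
  series_addA series_addC series_add0 series_addN.

Fact series_scaleA a b A :
  series_scale a (series_scale b A) = series_scale (a * b) A.
Proof. by apply/seriesP => w /=; rewrite mulrA. Qed.
Fact series_scale1 : left_id 1 series_scale.
Proof. by move=> A; apply/seriesP => w /=; rewrite mul1r. Qed.
Fact series_scaleDr : right_distributive series_scale +%R.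
Proof. by move=> c A B; apply/seriesP => w /=; rewrite mulrDr. Qed.
Fact series_scaleDl A : {morph series_scale^~ A : a b / a + b}.
Proof. by move=> a b; apply/seriesP => w /=; rewrite mulrDl. Qed.

HB.instance Definition _ := GRing.Zmodule_isLmodule.Build K S
  series_scaleA series_scale1 series_scaleDr series_scaleDl.

Definition series_shift x A : S := Series (fun w => A (x :: w)).

Fact series_mul_nil A B : series_mul A B [::] = A [::] * B [::].
Proof. by rewrite /= big_ord1. Qed.

Fact series_mul_cons A B x w :
  series_mul A B (x :: w) =
  A [::] * B (x :: w) + series_mul (series_shift x A) B w.
Proof. by rewrite /= big_ord_recl. Qed.

Fact series_mulDl : left_distributive series_mul +%R.
Proof.
move=> A B C; apply/seriesP => w /=; rewrite -big_split /=.
by apply: eq_bigr => i _; rewrite mulrDl.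
Qed.
Fact series_mulDr : right_distributive series_mul +%R.
Proof.
move=> A B C; apply/seriesP => w /=; rewrite -big_split /=.
by apply: eq_bigr => i _; rewrite mulrDr.
Qed.
Fact series_scaleAl c A B : c *: series_mul A B = series_mul (c *: A) B.
Proof.
apply/seriesP => w /=; rewrite mulr_sumr.
by apply: eq_bigr => i _; rewrite mulrA.
Qed.
Fact series_scaleAr c A B : c *: series_mul A B = series_mul A (c *: B).
Proof.
apply/seriesP => w /=; rewrite mulr_sumr.
by apply: eq_bigr => i _; rewrite mulrCA.
Qed.

Fact series_mul_shift A B x :
  series_shift x (series_mul A B) =
  A [::] *: series_shift x B + series_mul (series_shift x A) B.
Proof. by apply/seriesP => w; exact: series_mul_cons. Qed.

Fact series_mulA : associative series_mul.
Proof.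
move=> A B C; apply/seriesP => w; elim: w A B C => [|x w IHw] A B C.
  by rewrite !series_mul_nil mulrA.
rewrite (series_mul_cons A) (series_mul_cons (series_mul A B)) IHw.
rewrite series_mul_nil -mulrA series_mul_shift series_mulDl -series_scaleAl.
by rewrite (series_mul_cons B) mulrDr addrA.
Qed.

Fact series_mul1l : left_id series_one series_mul.
Proof.
move=> A; apply/seriesP => -[|x w]; first by rewrite series_mul_nil mul1r.
rewrite series_mul_cons mul1r [X in _ + X]big1 ?addr0 // => i _.
by rewrite mul0r.
Qed.

Fact series_mul1r : right_id series_one series_mul.
Proof.
move=> A; apply/seriesP => w; elim: w A => [|x w IHw] A.
  by rewrite series_mul_nil mulr1.
by rewrite series_mul_cons mulr0 add0r IHw.
Qed.

Fact series_one_neq0 : series_one != 0.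
Proof. by apply/eqP => /seriesP/(_ [::])/eqP; rewrite oner_eq0. Qed.

HB.instance Definition _ := GRing.Zmodule_isNzRing.Build S
  series_mulA series_mul1l series_mul1r series_mulDl series_mulDr
  series_one_neq0.

HB.instance Definition _ := GRing.Lmodule_isLalgebra.Build K S series_scaleAl.
HB.instance Definition _ := GRing.Lalgebra_isAlgebra.Build K S series_scaleAr.

Definition eps A : K := A [::].

Lemma epsM A B : eps (A * B) = eps A * eps B.
Proof. exact: series_mul_nil. Qed.

(* The coefficients of the right inverse [B] of [A] are determined by
   eps A * B (x :: w) = - (series_shift x A * B) w;  [n] is fuel. *)
Fixpoint series_inv_coef A n w : K :=
  if n isn't n'.+1 then (eps A)^-1 else
  if w isn't x :: w' then (eps A)^-1 else
  - (eps A)^-1 * \sum_(i < (size w').+1)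
      A (x :: take i w') * series_inv_coef A n' (drop i w').

Fact series_inv_coefE A n w :
  (size w <= n)%N -> series_inv_coef A n w = series_inv_coef A (size w) w.
Proof.
elim: n {-2}n (leqnn n) w => [|N IH] [|n] // leN [|x w] //= lew.
congr (_ * _); apply: eq_bigr => i _; congr (_ * _).
have le_d : (size (drop i w) <= size w)%N by rewrite size_drop leq_subr.
by rewrite (IH n leN _ (leq_trans le_d lew)) (IH _ (leq_trans lew leN)).
Qed.

Definition series_rinv A : S := Series (fun w => series_inv_coef A (size w) w).

Fact series_mulrV A : eps A != 0 -> A * series_rinv A = 1.
Proof.
move=> A0; apply/seriesP => -[|x w].
  by rewrite [LHS]series_mul_nil /= divff.
rewrite [LHS]series_mul_cons /= -/(eps A) mulrA mulrN divff // mulN1r.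
apply/eqP; rewrite addrC subr_eq0; apply/eqP/eq_bigr => i _; congr (_ * _).
by rewrite [RHS]series_inv_coefE // size_drop leq_subr.
Qed.

Fact series_mulVr A : eps A != 0 -> series_rinv A * A = 1.
Proof.
move=> A0; have AB := series_mulrV A0.
have B0 : eps (series_rinv A) != 0 by rewrite /eps /= invr_eq0.
by rewrite -{2}[A]mulr1 -(series_mulrV B0) (mulrA A) AB mul1r series_mulrV.
Qed.

Definition series_unit : {pred S} := fun A => eps A != 0.
Definition series_inv A : S := if A \in series_unit then series_rinv A else A.

Fact series_invl : {in series_unit, left_inverse 1 series_inv *%R}.
Proof. by move=> A uA; rewrite /series_inv uA series_mulVr. Qed.
Fact series_invr : {in series_unit, right_inverse 1 series_inv *%R}.
Proof. by move=> A uA; rewrite /series_inv uA series_mulrV. Qed.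
Fact series_unitP A B : B * A = 1 /\ A * B = 1 -> A \in series_unit.
Proof.
case=> /seriesP/(_ [::]); rewrite [LHS]series_mul_nil /= => BA _.
apply/eqP => A0; move/eqP: BA; rewrite -/(eps A) A0 mulr0 eq_sym.
by rewrite oner_eq0.
Qed.
Fact series_inv_out : {in [predC series_unit], series_inv =1 id}.
Proof. by move=> A; rewrite inE /series_inv => /negPf ->. Qed.

HB.instance Definition _ := GRing.NzRing_hasMulInverse.Build S
  series_invl series_invr series_unitP series_inv_out.

Lemma series_unitE A : (A \is a GRing.unit) = (eps A != 0).
Proof. by []. Qed.

Definition seriesX x : S := Series (fun w => (w == [:: x])%:R).

Definition rational : {pred S} := fun A =>
  `[< forall R : {pred S}, GRing.subalg_closed R ->
      (forall x, seriesX x \in R) ->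
      (forall B, B \is a GRing.unit -> B \in R -> B^-1 \in R) ->
      A \in R >].

Lemma rationalP A :
  reflect (forall R : {pred S}, GRing.subalg_closed R ->
      (forall x, seriesX x \in R) ->
      (forall B, B \is a GRing.unit -> B \in R -> B^-1 \in R) ->
      A \in R)
    (A \in rational).
Proof. exact: asboolP. Qed.

Lemma rational_subalg : GRing.subalg_closed rational.
Proof.
split=> [|c A B /rationalP rA /rationalP rB|A B /rationalP rA /rationalP rB];
  apply/rationalP => R Ra RX RV; have [R1 RL RM] := Ra; first exact: R1.
- by apply: RL; [exact: rA R Ra RX RV | exact: rB R Ra RX RV].
- by apply: RM; [exact: rA R Ra RX RV | exact: rB R Ra RX RV].
Qed.

Lemma rational_X x : seriesX x \in rational.
Proof. by apply/rationalP => R _ RX _; exact: RX. Qed.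

Lemma rational_inv A :
  A \is a GRing.unit -> A \in rational -> A^-1 \in rational.
Proof.
by move=> uA /rationalP rA; apply/rationalP => R Ra RX RV;
  exact: RV (rA R Ra RX RV).
Qed.

Definition srat := {A : S | (A \in rational) && (eps A == 1)}.

HB.instance Definition _ := SubChoice.on srat.

Fact srat_mul_subproof (a b : srat) :
  (val a * val b \in rational) && (eps (val a * val b) == 1).
Proof.
have [_ _ rM] := rational_subalg.
have /andP[rA /eqP eA] := valP a; have /andP[rB /eqP eB] := valP b.
by apply/andP; split; [exact: rM | rewrite epsM eA eB mulr1].
Qed.
Fact srat_one_subproof : ((1 : S) \in rational) && (eps 1 == 1).
Proof. by have [-> _ _] := rational_subalg; rewrite /eps /= eqxx. Qed.
Fact srat_unit (a : srat) : val a \is a GRing.unit.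
Proof. by have /andP[_ /eqP eA] := valP a; rewrite series_unitE eA oner_eq0. Qed.
Fact srat_inv_subproof (a : srat) :
  ((val a)^-1 \in rational) && (eps (val a)^-1 == 1).
Proof.
have /andP[rA /eqP eA] := valP a.
apply/andP; split; first exact: rational_inv (srat_unit a) rA.
have := epsM (val a) (val a)^-1; rewrite mulrV ?srat_unit // eA mul1r => <-.
by rewrite /eps /= eqxx.
Qed.

Definition srat_mul (a b : srat) : srat :=
  exist _ (val a * val b) (srat_mul_subproof a b).
Definition srat_one : srat := exist _ (1 : S) srat_one_subproof.
Definition srat_inv (a : srat) : srat :=
  exist _ (val a)^-1 (srat_inv_subproof a).

Fact srat_mulA : associative srat_mul.
Proof. by move=> a b c; apply: val_inj; rewrite /= mulrA. Qed.
Fact srat_mul1 : left_id srat_one srat_mul.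
Proof. by move=> a; apply: val_inj; rewrite /= mul1r. Qed.
Fact srat_mulr1 : right_id srat_one srat_mul.
Proof. by move=> a; apply: val_inj; rewrite /= mulr1. Qed.
Fact srat_mulV : left_inverse srat_one srat_inv srat_mul.
Proof. by move=> a; apply: val_inj; rewrite /= mulVr ?srat_unit. Qed.
Fact srat_mulrV : right_inverse srat_one srat_inv srat_mul.
Proof. by move=> a; apply: val_inj; rewrite /= mulrV ?srat_unit. Qed.

HB.instance Definition _ := isGroup.Build srat
  srat_mulA srat_mul1 srat_mulr1 srat_mulV srat_mulrV.

Fact srat_gen_subproof x :
  (1 + seriesX x \in rational) && (eps (1 + seriesX x) == 1).
Proof.
have [r1 rL _] := rational_subalg.
rewrite -[1 + _]addrC -[seriesX x]scale1r rL ?rational_X //=.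
by rewrite /eps /= mulr0 add0r eqxx.
Qed.

Definition rho T A : S := Series (fun w => A (w ++ T)).

Definition rho_closure A : set S := lspan (range (fun T => rho T A)).

Definition constants : set S := range (fun c : K => c%:A).

Definition norm (a : srat) : int :=
  (dim (sumspace (rho_closure (val a)) constants))%:Z - 1.

End Series.

Section FreeGroup.
Local Open Scope group_scope.
Variable X : finType.

(* [(x, true)] stands for the generator [x] and [(x, false)] for its inverse. *)
Definition letter := (X * bool)%type.
HB.instance Definition _ := Choice.on letter.
Implicit Types (a b : letter) (u v w : seq letter).

Definition flip a : letter := (a.1, ~~ a.2).

Definition reduced : pred (seq letter) := sorted (fun a b => b != flip a).

Definition freegroup := {w : seq letter | reduced w}.

HB.instance Definition _ := SubChoice.on freegroup.

Definition push a w : seq letter :=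
  if w is b :: w' then if b == flip a then w' else a :: w else [:: a].

Fact flipK : involutive flip.
Proof. by case=> x b; rewrite /flip /= negbK. Qed.

Fact push_reduced a w : reduced w -> reduced (push a w).
Proof.
case: w => [|b w] //=; case: ifPn => /= [_|-> //]; exact: path_sorted.
Qed.

Fact push_cons a w : reduced (a :: w) -> push a w = a :: w.
Proof. by case: w => [|b w] //= /andP[/negPf ->]. Qed.

Fact pushK a w : reduced w -> push (flip a) (push a w) = w.
Proof.
case: w => [|b w] /=; first by rewrite flipK eqxx.
case: ifPn => [/eqP -> rw|_ _ /=]; first exact: push_cons.
by rewrite flipK eqxx.
Qed.

Fact pushKV a w : reduced w -> push a (push (flip a) w) = w.
Proof. by move=> rw; rewrite -{1}(flipK a) pushK. Qed.

Definition free_cat u v : seq letter := foldr push v u.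

Fact free_cat_reduced u v : reduced v -> reduced (free_cat u v).
Proof. by move=> rv; elim: u => //= a u; exact: push_reduced. Qed.

Fact free_cat_push a u v :
  reduced v -> free_cat (push a u) v = push a (free_cat u v).
Proof.
case: u => [|b u] //= rv; case: ifPn => // /eqP -> /=.
by rewrite pushKV // free_cat_reduced.
Qed.

Fact free_catA u v w :
  reduced w -> free_cat u (free_cat v w) = free_cat (free_cat u v) w.
Proof. by move=> rw; elim: u => //= a u IHu; rewrite free_cat_push // IHu. Qed.

Fact free_cats0 u : reduced u -> free_cat u [::] = u.
Proof.
elim: u => //= a u IHu ru; rewrite IHu ?push_cons //; exact: path_sorted ru.
Qed.

Definition free_rev u : seq letter := rev (map flip u).

Fact free_revK : involutive free_rev.
Proof.
by move=> u; rewrite /free_rev map_rev revK mapK //; exact: flipK.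
Qed.

Fact free_rev_reduced u : reduced u -> reduced (free_rev u).
Proof.
rewrite /reduced /free_rev rev_sorted sorted_map.
apply: sub_sorted => a b /=; rewrite flipK; apply: contra => /eqP ->.
by [].
Qed.

Fact free_catV u : free_cat (free_rev u) u = [::].
Proof.
elim: u => //= a u IHu.
by rewrite /free_cat /free_rev /= rev_cons foldr_rcons /= flipK eqxx.
Qed.

Definition free_mul (g h : freegroup) : freegroup :=
  exist _ (free_cat (val g) (val h)) (free_cat_reduced (val g) (valP h)).
Definition free_one : freegroup := exist reduced [::] isT.
Definition free_inv (g : freegroup) : freegroup :=
  exist _ (free_rev (val g)) (free_rev_reduced (valP g)).

Fact free_mulA : associative free_mul.
Proof. by move=> f g h; apply: val_inj; exact: free_catA (valP h). Qed.
Fact free_mul1 : left_id free_one free_mul.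
Proof. by move=> g; exact: val_inj. Qed.
Fact free_mulr1 : right_id free_one free_mul.
Proof. by move=> g; apply: val_inj; exact: free_cats0 (valP g). Qed.
Fact free_mulV : left_inverse free_one free_inv free_mul.
Proof. by move=> g; apply: val_inj; exact: free_catV. Qed.
Fact free_mulrV : right_inverse free_one free_inv free_mul.
Proof.
by move=> g; apply: val_inj; rewrite /= -{1}(free_revK (val g)) free_catV.
Qed.

HB.instance Definition _ := isGroup.Build freegroup
  free_mulA free_mul1 free_mulr1 free_mulV free_mulrV.

Definition free_gen (x : X) : freegroup := exist reduced [:: (x, true)] isT.

Section Lift.
Variables (G : groupType) (f : X -> G).

Definition free_letter a : G := if a.2 then f a.1 else (f a.1)^-1.

Definition free_lift (g : freegroup) : G := \prod_(a <- val g) free_letter a.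

Fact free_letter_flip a : free_letter (flip a) = (free_letter a)^-1.
Proof. by case: a => x []; rewrite /free_letter //= invgK. Qed.

Fact free_liftM : {morph free_lift : g h / g * h}.
Proof.
move=> [u ru] [v rv]; rewrite /free_lift /= /free_cat {ru rv}.
elim: u => [|a u IHu] /=; first by rewrite big_nil mul1g.
rewrite big_cons -mulgA -IHu; case: (foldr _ _ _) => [|b w].
  by rewrite /= big_seq1 big_nil mulg1.
rewrite /=; case: ifP => [/eqP ->|_]; last by rewrite [LHS]big_cons.
by rewrite [in RHS]big_cons free_letter_flip mulVKg.
Qed.

HB.instance Definition _ :=
  isMultiplicative.Build freegroup G free_lift free_liftM.

Lemma free_lift_gen x : free_lift (free_gen x) = f x.
Proof. by rewrite /free_lift /= big_seq1. Qed.

Lemma free_lift_unique (h : {multiplicative freegroup -> G}) :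
  (forall x, h (free_gen x) = f x) -> h =1 free_lift.
Proof.
have h1 (k : {multiplicative freegroup -> G}) : k 1 = 1.
  by apply: (@mulgI _ (k 1)); rewrite -gmulfM !mulg1.
have hV (k : {multiplicative freegroup -> G}) x : k x^-1 = (k x)^-1.
  by apply: (@mulgI _ (k x)); rewrite -gmulfM !mulgV h1.
move=> hf [u ru]; elim: u ru => [|[x b] u IHu] ru.
  by rewrite (_ : exist reduced _ ru = 1 :> freegroup) ?h1 ?(h1 free_lift) //;
    exact: val_inj.
have ru' : reduced u by exact: path_sorted ru.
pose l : freegroup := if b then free_gen x else (free_gen x)^-1.
have -> : exist reduced _ ru = l * exist reduced u ru' :> freegroup.
  apply: val_inj; rewrite /l; case: b ru {l} => ru;
    exact/esym/(push_cons ru).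
rewrite !gmulfM IHu; congr (_ * _); rewrite /l.
case: b {ru l}; first by rewrite hf; exact/esym/free_lift_gen.
by rewrite (hV h) hf -(free_lift_gen x); exact/esym/(hV free_lift).
Qed.

End Lift.
End FreeGroup.

Section Words.
Local Open Scope group_scope.
Variable G : groupType.

Definition expgz (g : G) (n : int) : G :=
  match n with Posz p => g ^+ p | Negz p => g ^- p.+1 end.

Definition is_word_length (E : set G) (g : G) (n : nat) : Prop :=
  (exists s : seq G,
     [/\ forall x, x \in s -> E x, \prod_(x <- s) x = g & size s = n]) /\
  (forall s : seq G,
     (forall x, x \in s -> E x) -> \prod_(x <- s) x = g -> (n <= size s)%N).

End Words.

Definition generating_set (k : nat) : set (freegroup 'I_k) :=
  fun g => (exists i, g = free_gen i) \/ (exists i, g = (free_gen i)^-1%g) \/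
    (exists i j, i != j /\ g = (free_gen i / free_gen j)%g).

Arguments generating_set k : clear implicits.

(* Main.v *)
Require Import Defs.
From HB Require Import structures.
From mathcomp Require Import all_boot all_order all_algebra.
From mathcomp Require Import boolp classical_sets ring zify.

Import Order.TTheory GRing.Theory Num.Theory.
Local Open Scope ring_scope.

(** Write [g] as a reduced word [a_0 ... a_(n-1)] in the letters [g_i^{+-1}]
    and let [P_j] be the image of its prefix of length [j].  Since [rho_x] is a
    twisted derivation, [rho_x P_(j+1)] is [rho_x P_j] plus [P_j] if [a_j] is the
    generator [x], minus [P_(j+1)] if [a_j] is its inverse.  Hence the span of
    the [P_j] is stable under all [rho_x], and stays so after dropping the
    prefixes that end at a dip, that is just between a generator and the inverse
    of another one.  The [rho_x] are triangular for the filtration by prefix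
    length; comparing coefficients modulo its steps, and using that the word is
    reduced, shows that the [P_j] are linearly independent, and that a stable
    subspace containing [1] and [P_n] contains every [P_j] that is not dropped.
    So [norm (mu g)] is the number of letters minus the number of dips.
    Multiplying by one element of the generating set raises this number by at
    most [1], while merging the two letters at each dip attains it. *)

(** * Subspaces as predicates, and their extension by one vector *)

Section Adjoin.
Set Implicit Arguments.
Unset Strict Implicit.
Unset Printing Implicit Defensive.
Local Open Scope classical_set_scope.
Context {K : fieldType} {V : lmodType K}.
Implicit Types (Z : set V) (p u v : V).

Definition subspace Z := Z 0 /\ forall c u v, Z u -> Z v -> Z (c *: u + v).

(** This is [Z + K p], phrased so that membership reads as a congruence to [c p] modulo [Z]. *)
Definition adjoin Z p : set V := [set v | exists c : K, Z (v - c *: p)].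

Lemma subspaceD Z u v : subspace Z -> Z u -> Z v -> Z (u + v).
Proof. by case=> _ ZL Zu Zv; rewrite -[u]scale1r; exact: ZL. Qed.

Lemma subspaceZ Z c u : subspace Z -> Z u -> Z (c *: u).
Proof. by case=> Z0 ZL Zu; rewrite -[_ *: _]addr0; exact: ZL. Qed.

Lemma subspace_sum Z n (F : 'I_n -> V) :
  subspace Z -> (forall i, Z (F i)) -> Z (\sum_(i < n) F i).
Proof.
move=> sZ ZF; elim/big_ind: _ => //; first by case: sZ.
by move=> u v; exact: subspaceD.
Qed.

Lemma subspace_unscale Z c u : subspace Z -> c != 0 -> Z (c *: u) -> Z u.
Proof.
by move=> sZ c0 /(subspaceZ c^-1 sZ); rewrite scalerA mulVf // scale1r.
Qed.

Lemma sub_adjoin Z p : Z `<=` adjoin Z p.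
Proof. by move=> v Zv; exists 0; rewrite scale0r subr0. Qed.

Lemma mem_adjoin Z p : Z 0 -> adjoin Z p p.
Proof. by move=> Z0; exists 1; rewrite scale1r subrr. Qed.

Lemma adjoin_sub Z Z' p : subspace Z' -> Z `<=` Z' -> Z' p -> adjoin Z p `<=` Z'.
Proof.
move=> sZ' ZZ' Z'p v [c /ZZ' Z'v]; rewrite -(subrK (c *: p) v).
by apply: subspaceD => //; exact: subspaceZ.
Qed.

Lemma subspace_adjoin Z p : subspace Z -> subspace (adjoin Z p).
Proof.
move=> sZ; split=> [|c u v [d Zu] [e Zv]].
  by apply: sub_adjoin; case: sZ.
exists (c * d + e); case: sZ => _ /(_ c _ _ Zu Zv); congr Z.
by rewrite scalerBr scalerA scalerDl opprD addrACA.
Qed.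

Lemma subspace_lspan Z : subspace (lspan Z).
Proof.
split=> [|c _ _ [n [d [s [Zs ->]]]] [n' [d' [s' [Zs' ->]]]]].
  by exists 0%N, (fun=> 0), (fun=> 0); split=> [[]//|]; rewrite big_ord0.
exists (n + n')%N,
  (fun i => match split i with inl j => c * d j | inr j => d' j end),
  (fun i => match split i with inl j => s j | inr j => s' j end).
split=> [i|]; first by case: split.
rewrite big_split_ord scaler_sumr; congr (_ + _); apply: eq_bigr => i _.
  by rewrite (unsplitK (inl i)) scalerA.
by rewrite (unsplitK (inr i)).
Qed.

Lemma sub_lspan Z : Z `<=` lspan Z.
Proof.
move=> v Zv; exists 1%N, (fun=> 1), (fun=> v); split=> //.
by rewrite big_ord1 scale1r.
Qed.

Lemma subspace_sumspace Z Z' :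
  subspace Z -> subspace Z' -> subspace (sumspace Z Z').
Proof.
move=> sZ sZ'; split.
  by exists 0; [case: sZ | exists 0; [case: sZ' | rewrite addr0]].
move=> c _ _ [u Zu [v Z'v <-]] [u' Zu' [v' Z'v' <-]].
exists (c *: u + u'); first by case: sZ => _; exact.
exists (c *: v + v'); first by case: sZ' => _; exact.
by rewrite scalerDr addrACA.
Qed.

Lemma has_dim_zero : has_dim [set (0 : V)] 0.
Proof.
exists (fun=> 0); split=> [c _ []//|]; apply/seteqP; split=> v /=.
  by move=> ->; exists (fun=> 0); rewrite big_ord0.
by case=> c; rewrite big_ord0.
Qed.

Lemma has_dim_adjoin Z p d :
  subspace Z -> ~ Z p -> has_dim Z d -> has_dim (adjoin Z p) d.+1.
Proof.
move=> sZ nZp [b [bfree ZE]].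
(* The new vector [p] takes the last index, the old basis the others. *)
pose b' (i : 'I_d.+1) := if unlift ord_max i is Some j then b j else p.
have bE (c : 'I_d.+1 -> K) : \sum_(i < d.+1) c i *: b' i =
    \sum_(i < d) c (lift ord_max i) *: b i + c ord_max *: p.
  rewrite (bigD1_ord ord_max) //= addrC /b' unlift_none; congr (_ + _).
  by apply: eq_bigr => i _; rewrite liftK.
exists b'; split=> [c|].
  rewrite bE => c0.
  have Zcp : Z (- (c ord_max *: p)).
    by rewrite -(addr0_eq c0) opprK ZE; exists (fun i => c (lift ord_max i)).
  have c_max : c ord_max = 0.
    apply: contrapT => /eqP cn0; apply: nZp.
    by apply: (@subspace_unscale _ (- c ord_max)); rewrite ?oppr_eq0 ?scaleNr.
  move: c0; rewrite c_max scale0r addr0 => /bfree cl i.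
  by case: (unliftP ord_max i) => [j|] ->.
apply/seteqP; split=> v /=.
  case=> e; rewrite ZE /= => -[c vE].
  exists (fun i => if unlift ord_max i is Some j then c j else e).
  rewrite bE unlift_none -(subrK (e *: p) v) vE; congr (_ + _).
  by apply: eq_bigr => i _; rewrite liftK.
case=> c ->; exists (c ord_max); rewrite bE addrK ZE.
by exists (fun i => c (lift ord_max i)).
Qed.

End Adjoin.

(** * The operators [rho] on products, and the subspaces they stabilize *)

Section RationalSeries.
Local Open Scope classical_set_scope.
Set Implicit Arguments.
Unset Strict Implicit.
Unset Printing Implicit Defensive.
Context {K : fieldType} {X : finType}.
Local Notation S := (series K X).
Implicit Types (A B p q : S) (Z : set S) (x y z : X) (c d : K).

Lemma coefD A B w : (A + B) w = A w + B w. Proof. by []. Qed.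
Lemma coefN A w : (- A) w = - A w. Proof. by []. Qed.
Lemma coefZ c A w : (c *: A) w = c * A w. Proof. by []. Qed.

Local Ltac coef_ring :=
  apply/seriesP => ?; rewrite ?(coefD, coefN, coefZ); ring.

Local Notation rho1 x := (rho [:: x]).

Lemma rho0 T : rho T (0 : S) = 0.
Proof. by apply/seriesP. Qed.

Lemma rhoD T A B : rho T (A + B) = rho T A + rho T B.
Proof. by apply/seriesP. Qed.

Lemma rhoB T A B : rho T (A - B) = rho T A - rho T B.
Proof. by apply/seriesP. Qed.

Lemma rhoZ T c A : rho T (c *: A) = c *: rho T A.
Proof. by apply/seriesP. Qed.

Lemma rho1_rho x T A : rho1 x (rho T A) = rho (x :: T) A.
Proof. by apply/seriesP => w; rewrite /= -catA. Qed.

(** In a splitting of [w x] the final [x] falls to [B], unless the part read by [B] is empty; that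
    case gives the [eps B] term. *)
Lemma rho1_mul x A B : rho1 x (A * B) = A * rho1 x B + eps B *: rho1 x A.
Proof.
apply/seriesP => w; rewrite coefD coefZ /= cats1 size_rcons big_ord_recr /=.
rewrite (take_oversize (s := rcons w x)) ?size_rcons //.
rewrite (drop_oversize (s := rcons w x)) ?size_rcons // mulrC; congr (_ + _).
apply: eq_bigr => i _; have le_iw : (i <= size w)%N by rewrite -ltnS.
by rewrite -cats1 takel_cat // drop_cat cats1 -cats1; case: ltngtP le_iw => // ->;
  rewrite subnn drop_size.
Qed.

Definition magnus (a : letter X) : S :=
  if a.2 then 1 + seriesX K a.1 else (1 + seriesX K a.1)^-1.

Lemma eps1 : eps (1 : S) = 1. Proof. by []. Qed.

Lemma eps_gen y : eps (1 + seriesX K y) = 1.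
Proof. by rewrite /eps coefD /= addr0. Qed.

Lemma eps_magnus a : eps (magnus a) = 1.
Proof.
case: a => y [] /=; first exact: eps_gen.
have uy : 1 + seriesX K y \is a GRing.unit.
  by rewrite series_unitE eps_gen oner_eq0.
by have := epsM (1 + seriesX K y) (1 + seriesX K y)^-1;
  rewrite mulrV // eps1 eps_gen mul1r.
Qed.

Lemma rho1_1 x : rho1 x (1 : S) = 0.
Proof. by apply/seriesP => w /=; rewrite cats1; case: w. Qed.

Lemma rho1_gen x y : rho1 x (1 + seriesX K y) = (x == y)%:R.
Proof.
rewrite rhoD rho1_1 add0r; apply/seriesP => w.
rewrite -scaler_nat coefZ /= cats1 -[[:: y]]/(rcons [::] y) eqseq_rcons andbC.
by case: (x == y) (w == [::]) => [] [] /=; rewrite ?mulr1 ?mulr0.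
Qed.

Lemma rho1_mul_pos A x y :
  rho1 x (A * magnus (y, true)) = rho1 x A + (x == y)%:R *: A.
Proof.
rewrite rho1_mul eps_magnus scale1r /magnus /= rho1_gen addrC; congr (_ + _).
by case: (x == y); rewrite ?mulr1 ?mulr0 ?scale1r ?scale0r.
Qed.

(** The positive formula is applied to [A * magnus (y, false)], whose product with
    [magnus (y, true)] is [A]. *)
Lemma rho1_mul_neg A x y :
  rho1 x (A * magnus (y, false)) =
  rho1 x A - (x == y)%:R *: (A * magnus (y, false)).
Proof.
apply/esym/eqP; rewrite subr_eq -rho1_mul_pos -mulrA /magnus /= mulVr ?mulr1 //.
by rewrite series_unitE eps_gen oner_eq0.
Qed.

Definition rho_stable Z := forall x A, Z A -> Z (rho1 x A).

Lemma rho_stable_adjoin Z p : subspace Z -> rho_stable Z ->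
  (forall x, exists l, Z (rho1 x p - l *: p)) -> rho_stable (adjoin Z p).
Proof.
move=> sZ rZ Zp x A [c /(rZ x)]; have [l Zl] := Zp x.
exists (c * l); rewrite (_ : _ - _ = rho1 x (A - c *: p) +
  c *: (rho1 x p - l *: p)).
  by apply: subspaceD => //; exact: subspaceZ.
by rewrite rhoB rhoZ; coef_ring.
Qed.

Lemma rho_stable_closure A : rho_stable (rho_closure A).
Proof.
move=> x _ [n [c [s [As ->]]]].
rewrite (big_morph _ (rhoD [:: x]) (rho0 [:: x])).
apply: subspace_sum => [|i]; first exact: subspace_lspan.
rewrite rhoZ; apply: subspaceZ; first exact: subspace_lspan.
by apply: sub_lspan; have [T _ <-] := As i; exists (x :: T); rewrite // rho1_rho.
Qed.

(** Modulo [Z], [rho1 x q] is [c l p] by stability and [(l + d) p] by the given formula; the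
    difference lies in [Z]. *)
Lemma rho_stable_mod_pos Z p q x l c d : subspace Z -> rho_stable Z ->
  Z (rho1 x p - l *: p) -> Z (q - c *: p) ->
  rho1 x q = rho1 x p + d *: p -> Z ((d + l - c * l) *: p).
Proof.
move=> sZ rZ Zp /(rZ x) Zq qE; rewrite (_ : _ *: _ =
  rho1 x (q - c *: p) + (c - 1) *: (rho1 x p - l *: p)).
  by apply: subspaceD => //; exact: subspaceZ.
by rewrite rhoB rhoZ qE; coef_ring.
Qed.

(** The same double computation, with [d q] congruent to [d c p]. *)
Lemma rho_stable_mod_neg Z p q x l c d : subspace Z -> rho_stable Z ->
  Z (rho1 x p - l *: p) -> Z (q - c *: p) ->
  rho1 x q = rho1 x p - d *: q -> Z ((l - d * c - c * l) *: p).
Proof.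
move=> sZ rZ Zp Zq qE; rewrite (_ : _ *: _ = rho1 x (q - c *: p) +
  ((c - 1) *: (rho1 x p - l *: p) + d *: (q - c *: p))).
  apply: subspaceD => //; first exact: rZ.
  by apply: subspaceD => //; exact: subspaceZ.
by rewrite rhoB rhoZ qE; coef_ring.
Qed.

(** * Prefix products and the flag of their spans *)

Section Prefixes.
Variable a : nat -> letter X.

Implicit Type I : pred nat.

Definition magnus_prefix n : S := \prod_(i < n) magnus (a i).

Lemma prefix0 : magnus_prefix 0 = 1. Proof. exact: big_ord0. Qed.

Lemma prefixS n : magnus_prefix n.+1 = magnus_prefix n * magnus (a n).
Proof. exact: big_ord_recr. Qed.

Lemma eps_prefix n : eps (magnus_prefix n) = 1.
Proof.
elim: n => [|n IHn]; first by rewrite prefix0 eps1.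
by rewrite prefixS epsM IHn eps_magnus mulr1.
Qed.

Lemma rho1_prefix_pos x n : (a n).2 ->
  rho1 x (magnus_prefix n.+1) =
  rho1 x (magnus_prefix n) + (x == (a n).1)%:R *: magnus_prefix n.
Proof. by rewrite prefixS; case: (a n) => y [] //= _; exact: rho1_mul_pos. Qed.

Lemma rho1_prefix_neg x n : ~~ (a n).2 ->
  rho1 x (magnus_prefix n.+1) =
  rho1 x (magnus_prefix n) - (x == (a n).1)%:R *: magnus_prefix n.+1.
Proof. by rewrite prefixS; case: (a n) => y [] //= _; exact: rho1_mul_neg. Qed.

(** Index [n] is the gap before letter [n], so [0] is never a dip. That the two letters involve
    different generators comes from reducedness. *)
Definition dip n := if n is m.+1 then (a m).2 && ~~ (a n).2 else false.

(** [I] selects the prefixes kept: [predT] serves for independence, [predC dip] for the space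
    measured by [norm]. *)
Fixpoint prefix_span (I : pred nat) n : set S :=
  if n isn't m.+1 then [set 0] else
  if I m then adjoin (prefix_span I m) (magnus_prefix m) else prefix_span I m.

Lemma subspace_prefix_span I n : subspace (prefix_span I n).
Proof.
elim: n => [|n IHn] /=; last by case: (I n) => //; exact: subspace_adjoin.
by split=> // c u v /= -> ->; rewrite scaler0 addr0.
Qed.
#[local] Hint Resolve subspace_prefix_span : core.

Lemma prefix_span_sub I n Z : subspace Z ->
  (forall i, (i < n)%N -> I i -> Z (magnus_prefix i)) -> prefix_span I n `<=` Z.
Proof.
move=> sZ; elim: n => [_ v /= ->|n IHn In]; first by case: sZ.
have /IHn In' i : (i < n)%N -> I i -> Z (magnus_prefix i).
  by move=> /ltnW; exact: In.
by rewrite /=; case: ifP => // In0; apply: adjoin_sub => //; exact: In.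
Qed.

Lemma mem_prefix_span I n i :
  (i < n)%N -> I i -> prefix_span I n (magnus_prefix i).
Proof.
elim: n => // n IHn; rewrite ltnS leq_eqVlt => /predU1P[->|lt_in] Ii /=.
  by rewrite Ii; apply: mem_adjoin; case: (subspace_prefix_span I n).
case: ifP => _; last exact: IHn.
by apply: sub_adjoin; exact: IHn.
Qed.

(* Diagonal coefficients of the triangular operators [rho1 x], see
   [rho1_prefix]. *)
Definition rho_eig n x : K := if n is m.+1 then - (a m == (x, false))%:R else 0.

Lemma rho1_prefix I n x : (forall j, ~~ dip j -> I j) -> I n ->
  prefix_span I n (rho1 x (magnus_prefix n) - rho_eig n x *: magnus_prefix n).
Proof.
move=> HI; have pos0 j : (a j).2 -> I j.
  by move=> aj; apply: HI; case: j aj => //= j ->; rewrite andbF.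
have step j : I j ->
    prefix_span I j
      (rho1 x (magnus_prefix j) - rho_eig j x *: magnus_prefix j) ->
    prefix_span I j.+1 (rho1 x (magnus_prefix j)).
  by move=> Ij IHj; rewrite /= Ij; exists (rho_eig j x).
elim/ltn_ind: n => -[|n] IHn In.
  by rewrite prefix0 rho1_1 scale0r subr0.
have stepP j : (j <= n)%N -> (a j).2 ->
    prefix_span I j.+1 (rho1 x (magnus_prefix j.+1)).
  move=> le_jn aj; rewrite rho1_prefix_pos //; apply: subspaceD => //.
    by apply: step; [exact: pos0 | apply: IHn => //; exact: pos0].
  by apply: subspaceZ => //; apply: mem_prefix_span => //; exact: pos0.
case: (boolP (a n).2) => an.
  have -> : rho_eig n.+1 x = 0.
    rewrite /rho_eig; case: (a n) an => y [] //= _.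
    by rewrite xpair_eqE andbF oppr0.
  by rewrite scale0r subr0; exact: stepP.
have -> : rho_eig n.+1 x = - (x == (a n).1)%:R.
  rewrite /rho_eig; case: (a n) an => y [] //= _.
  by rewrite xpair_eqE andbT eq_sym.
rewrite rho1_prefix_neg // scaleNr opprK subrK.
have [Ind|nIn] := boolP (I n); first by apply: step => //; exact: IHn.
(* A missing index [n] is a dip, so the letter before it is a generator and [stepP] applies one
   index lower. *)
have : dip n by apply: contraNT nIn; exact: HI.
case: n an nIn {In step} IHn stepP => //= n _ /negPf -> _ stepP /andP[an _].
by apply: stepP.
Qed.

Lemma rho_stable_prefix_span I n : (forall j, ~~ dip j -> I j) ->
  rho_stable (prefix_span I n).
Proof.
move=> HI; elim: n => [x _ ->|n IHn] /=.
  exact: rho0.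
case: ifP => // In; apply: rho_stable_adjoin => // x.
by exists (rho_eig n x); exact: rho1_prefix.
Qed.

(** * Reducedness: independence of prefixes, and their recovery in stable subspaces *)

Definition reduced_upto n := forall j, (j.+1 < n)%N -> a j.+1 != flip (a j).

(** A nonzero value would make letter [n - 1] the inverse of letter [n]. *)
Lemma rho_eig_pos n : reduced_upto n.+1 -> (a n).2 -> rho_eig n (a n).1 = 0.
Proof.
case: n => // n /(_ n (leqnn _)) red_n an1 /=.
case: eqP => [an|_]; last by rewrite oppr0.
by case/eqP: red_n; rewrite an; case: (a n.+1) an1 => y [].
Qed.

(** Strong induction. If [P_(n+1)] is [c P_n] modulo earlier prefixes, every [rho1 x] yields a
    coefficient of [P_n] that must vanish. This is consistent only when letter [n] is an inverse
    that comes first or follows a generator, and then [c = 0]. *)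
Lemma prefix_notin_span n :
  reduced_upto n -> ~ prefix_span predT n (magnus_prefix n).
Proof.
elim/ltn_ind: n => -[|n] IHn red.
  by rewrite prefix0 /= => /eqP; rewrite oner_eq0.
have {}IHn j : (j <= n)%N -> ~ prefix_span predT j (magnus_prefix j).
  by move=> le_jn; apply: IHn => // i lt_ij; apply: red; lia.
have key j c : (j <= n)%N -> prefix_span predT j (c *: magnus_prefix j) -> c = 0.
  move=> /IHn nj; apply: contraPeq => c0 /subspace_unscale.
  by move=> /(_ (subspace_prefix_span _ _) c0).
have stab := @rho_stable_prefix_span predT _ (fun _ _ => isT).
have eig j x := @rho1_prefix predT j x (fun _ _ => isT) isT.
case=> c Zc.
have [an|an] := boolP (a n).2.
  have := rho_stable_mod_pos _ (stab n) (eig n (a n).1) Zc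
    (rho1_prefix_pos _ an).
  rewrite rho_eig_pos // eqxx mulr0 subr0 addr0.
  move=> /(_ (subspace_prefix_span _ _)).
  by move/key => /(_ (leqnn n))/eqP; rewrite oner_eq0.
have eq0 x : rho_eig n x - (x == (a n).1)%:R * c - c * rho_eig n x = 0.
  apply: (key n) => //; apply: (rho_stable_mod_neg _ (stab n) (eig n x) Zc) => //.
  exact: rho1_prefix_neg.
have Zn1 : c = 0 -> prefix_span predT n (magnus_prefix n.+1).
  by move=> c0; rewrite c0 scale0r subr0 in Zc.
have c0 : rho_eig n (a n).1 = 0 -> c = 0.
  by move=> e; have /eqP := eq0 (a n).1; rewrite e eqxx mul1r mulr0 subr0 sub0r
    oppr_eq0 => /eqP.
(* For [n = 0] all eigenvalues vanish, hence [c = 0] and [P_1 = 0], against its constant coefficient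
   [1]. *)
case: n an red {IHn Zc} stab eig key eq0 Zn1 c0 => [|n] an red stab eig key eq0.
  move=> /[swap] /(_ erefl) /[swap] /[apply] /= P0.
  by have /eqP := eps_prefix 1; rewrite P0 eq_sym oner_eq0.
move=> Zn1 c0; have red_n := red n (leqnn _).
case an1: (a n) red_n => [y [|]] red_n; last first.
  (* Two consecutive inverses: the equation at [y] becomes [-1 = 0], directly if the letters agree
     and after [c = 0] otherwise. *)
  have ey : rho_eig n.+1 y = -1 by rewrite /= an1 eqxx.
  have := eq0 y; rewrite ey.
  have [yE|neq_yx] := eqVneq y (a n.+1).1.
    by rewrite mul1r mulrN1 opprK subrK => /eqP; rewrite oppr_eq0 oner_eq0.
  rewrite c0 ?mulr0 ?mul0r ?subr0 => [/eqP|]; first by rewrite oppr_eq0 oner_eq0.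
  by rewrite /= an1 xpair_eqE (negPf neq_yx) oppr0.
(* An inverse after a generator: with [c = 0], [P_(n+2)] is [d P_n] modulo earlier prefixes. Since
   [rho1 y] ignores letter [n + 1], it yields a coefficient [1] of [P_n]. *)
have /Zn1/= : c = 0 by apply: c0; rewrite /= an1 xpair_eqE andbF oppr0.
move=> {Zn1} [d Zd].
have neq_y : y != (a n.+1).1.
  by apply: contraNneq red_n => ->; case: (a n.+1) an => z [].
have an1' : (a n).2 by rewrite an1.
have /key : prefix_span predT n
    ((1 + rho_eig n y - d * rho_eig n y) *: magnus_prefix n).
  apply: (rho_stable_mod_pos _ (stab n) (eig n y) Zd) => //.
  rewrite rho1_prefix_neg // (negPf neq_y) scale0r subr0 rho1_prefix_pos //.
  by rewrite an1 eqxx.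
have -> : rho_eig n y = 0.
  have := @rho_eig_pos n; rewrite an1 /=; apply=> // j lt_jn.
  exact: red j (ltnW lt_jn).
rewrite mulr0 subr0 addr0 => /(_ (leqnSn _))/eqP.
by rewrite oner_eq0.
Qed.

(** Prefixes are recovered in increasing order: once all later ones lie in [adjoin Z P_s], applying
    [rho1 x] to one of them forces [P_s] into [Z]. The hypothesis on letter [n] keeps the endpoint
    from being a dip. *)
Lemma prefix_mem_stable n Z : reduced_upto n -> (a n).2 ->
    subspace Z -> rho_stable Z -> Z (magnus_prefix 0) -> Z (magnus_prefix n) ->
  forall i, (i <= n)%N -> ~~ dip i -> Z (magnus_prefix i).
Proof.
move=> red an sZ rZ Z0 Zn.
(* [Z] is generalized because the induction hypothesis is used for [adjoin Z P_s]; [k] bounds the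
   number of indices left. *)
suff gen k : forall s Z, (0 < s)%N -> (n.+1 - s < k)%N ->
    subspace Z -> rho_stable Z -> Z (magnus_prefix n) ->
    (forall i, (i < s)%N -> ~~ dip i -> Z (magnus_prefix i)) ->
    forall i, (i <= n)%N -> ~~ dip i -> Z (magnus_prefix i).
  by apply: (gen n.+1 1%N) => //; [rewrite subn1 | case].
elim: k => // k IHk {sZ rZ Z0 Zn}s {}Z s_gt0; rewrite ltnS => le_k sZ rZ Zn Zs.
have [lt_ns i le_in|le_sn] := ltnP n s.
  by apply: Zs; exact: leq_ltn_trans le_in lt_ns.
have lt_k : (n.+1 - s.+1 < k)%N by lia.
suff Zps : ~~ dip s -> Z (magnus_prefix s).
  apply: (IHk s.+1) => //.
  by move=> i; rewrite ltnS leq_eqVlt => /predU1P[->|]; [exact: Zps | exact: Zs].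
move=> dip_s; move: le_sn; rewrite leq_eqVlt => /predU1P[->//|lt_sn].
have Zeig x : Z (rho1 x (magnus_prefix s) - rho_eig s x *: magnus_prefix s).
  have := @rho1_prefix (predC dip) s x (fun _ => id) dip_s.
  by apply: prefix_span_sub => // i lt_is; exact: Zs.
have red_s : reduced_upto s.+1 by move=> j lt_js; apply: red; lia.
have {IHk} adj i : (i <= n)%N -> ~~ dip i ->
    adjoin Z (magnus_prefix s) (magnus_prefix i).
  apply: (IHk s.+1) => //; first exact: subspace_adjoin.
  - by apply: rho_stable_adjoin => // x; exists (rho_eig s x).
  - exact: sub_adjoin.
  - move=> j; rewrite ltnS leq_eqVlt => /predU1P[-> _|lt_js nj].
    by apply: mem_adjoin; case: sZ.
  by apply: sub_adjoin; exact: Zs.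
have [as_pos|as_neg] := boolP (a s).2.
  (* If [s + 1] is a dip, [P_(s+2)] replaces [P_(s+1)]: this [rho1] ignores the inverse of another
     generator. *)
  have [q Zq qE] : exists2 q, adjoin Z (magnus_prefix s) q &
      rho1 (a s).1 q = rho1 (a s).1 (magnus_prefix s) + 1 *: magnus_prefix s.
    have [dip_s1|ndip] := boolP (dip s.+1); last first.
      exists (magnus_prefix s.+1); first exact: adj.
      by rewrite rho1_prefix_pos // eqxx.
    move: dip_s1 => /= /andP[_ as1].
    have lt_s1n : (s.+1 < n)%N.
      by rewrite ltn_neqAle lt_sn andbT; apply: contraNneq as1 => ->.
    exists (magnus_prefix s.+2); first by apply: adj => //=; rewrite (negPf as1).
    rewrite rho1_prefix_neg // rho1_prefix_pos // eqxx.
    have /negPf -> : (a s).1 != (a s.+1).1; last by rewrite scale0r subr0.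
    apply: contraNneq (red _ lt_s1n); case: (a s) as_pos => y [] //= _ ->.
    by case: (a s.+1) as1 => z [].
  have [c Zc] := Zq.
  have := rho_stable_mod_pos sZ rZ (Zeig (a s).1) Zc qE.
  by rewrite rho_eig_pos // mulr0 subr0 addr0 scale1r.
have [c Zc] : adjoin Z (magnus_prefix s) (magnus_prefix s.+1).
  by apply: adj => //=; rewrite (negPf as_neg).
have Zx x : Z ((rho_eig s x - (x == (a s).1)%:R * c - c * rho_eig s x)
    *: magnus_prefix s).
  by apply: (rho_stable_mod_neg sZ rZ (Zeig x) Zc); exact: rho1_prefix_neg.
(* As [s] is positive and not a dip, and letter [s] is an inverse, so is letter [s - 1]. *)
case: s s_gt0 as_neg dip_s {le_k lt_k Zs lt_sn Zeig red_s adj Zc} Zx => // s _.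
move=> as_neg as1 Zx.
rewrite /= as_neg andbT in as1.
have ey : rho_eig s.+1 (a s).1 = -1.
  by rewrite /=; case: (a s) as1 => y [] //= _; rewrite eqxx.
have [yE|neq_yx] := eqVneq (a s).1 (a s.+1).1.
  have := Zx (a s).1; rewrite ey yE eqxx mul1r mulrN1 opprK subrK.
  by apply: subspace_unscale; rewrite ?oppr_eq0 ?oner_eq0.
have := Zx (a s.+1).1; have -> : rho_eig s.+1 (a s.+1).1 = 0.
  rewrite /=; case: (a s) neq_yx as1 => y [] //= neq_yx _.
  by rewrite xpair_eqE (negPf neq_yx) oppr0.
rewrite eqxx mul1r mulr0 subr0 sub0r.
(* A nonzero [c] gives [P_s] at once; [c = 0] leaves coefficient [-1] at the previous letter. *)
have [c0 _|c_neq0] := eqVneq c 0; last first.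
  by apply: subspace_unscale; rewrite ?oppr_eq0.
have := Zx (a s).1; rewrite ey c0 (negPf neq_yx) !mul0r !subr0.
by apply: subspace_unscale; rewrite ?oppr_eq0 ?oner_eq0.
Qed.

Lemma has_dim_prefix_span n : reduced_upto n ->
  has_dim (prefix_span (predC dip) n.+1) (count (predC dip) (iota 0 n.+1)).
Proof.
move=> red; suff: forall k, (k <= n.+1)%N ->
    has_dim (prefix_span (predC dip) k) (count (predC dip) (iota 0 k)) by exact.
elim=> [_|k IHk lt_kn]; first exact: has_dim_zero.
have -> : iota 0 k.+1 = iota 0 k ++ [:: k] by rewrite -addn1 iotaD.
rewrite count_cat /= addn0.
have {IHk} := IHk (ltnW lt_kn); case: (dip k) => /=; first by rewrite addn0.
rewrite addn1; apply: has_dim_adjoin => // Pk.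
apply: (@prefix_notin_span k); first by move=> j lt_jk; apply: red; lia.
by apply: prefix_span_sub Pk => // i lt_ik _; exact: mem_prefix_span.
Qed.

(** The right side is stable and contains [1] and [P_n]; conversely the left side satisfies the
    hypotheses of [prefix_mem_stable]. *)
Lemma rho_closure_constants_prefix n : reduced_upto n -> (a n).2 ->
  sumspace (rho_closure (magnus_prefix n)) (@constants K X) =
  prefix_span (predC dip) n.+1.
Proof.
move=> red an; have sub_dip j : ~~ dip j -> predC dip j by [].
have sW := subspace_prefix_span (predC dip) n.+1.
have rW := @rho_stable_prefix_span (predC dip) n.+1 sub_dip.
have Wn : prefix_span (predC dip) n.+1 (magnus_prefix n).
  apply: mem_prefix_span => //=; case: n an {red sW rW} => //= n ->.
  by rewrite andbF.
have W1 : prefix_span (predC dip) n.+1 1.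
  by rewrite -prefix0; exact: mem_prefix_span.
apply/seteqP; split.
  move=> _ [_ [m [c [s [rs ->]]]] [_ [d _ <-] <-]].
  apply: subspaceD => //; last exact: subspaceZ.
  apply: subspace_sum => // i; apply: subspaceZ => //.
  have [T _ <-] := rs i; elim: T => [|x T IHT]; last first.
    by rewrite -rho1_rho; exact: rW.
  rewrite (_ : rho _ _ = magnus_prefix n) //; apply/seriesP => w.
  by rewrite /= cats0.
have sC : subspace (@constants K X).
  split; first by exists 0; rewrite ?scale0r.
  move=> c _ _ [d _ <-] [e _ <-]; exists (c * d + e) => //.
  by rewrite scalerDl scalerA.
have sA : subspace (rho_closure (magnus_prefix n)) by exact: subspace_lspan.
have sU := subspace_sumspace sA sC.
apply: prefix_span_sub => // i; rewrite ltnS.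
apply: (prefix_mem_stable red an sU).
- move=> x _ [u Uu [_ [c _ <-] <-]]; exists (rho1 x u).
    exact: rho_stable_closure.
  by exists 0; [exists 0; rewrite ?scale0r | rewrite rhoD rhoZ rho1_1 scaler0].
- exists 0; first by case: sA.
  by exists 1; [exists 1; rewrite ?scale1r | rewrite add0r prefix0].
- exists (magnus_prefix n).
    apply: sub_lspan; exists [::] => //; apply/seriesP => w.
    by rewrite /= cats0.
  by exists 0; [exists 0; rewrite ?scale0r | rewrite addr0].
Qed.

End Prefixes.
End RationalSeries.

(** * Letters minus dips, as a cost on words *)

Section WordCost.
Set Implicit Arguments.
Unset Strict Implicit.
Unset Printing Implicit Defensive.
Context {X : finType}.
Implicit Types (x y : X) (a b : letter X) (v w : seq (letter X)).

Definition starts_neg w := if w is b :: _ then ~~ b.2 else false.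

(** Each dip is charged to the generator just before it, which then counts zero. *)
Fixpoint cost w : nat :=
  if w is a :: w' then (~~ (a.2 && starts_neg w') + cost w')%N else 0%N.

(** Letter [j] matches index [j + 1], and index [0] is the extra unit. The positive default letter
    keeps the end of the word from being a dip. *)
Lemma count_dip x0 w :
  count (predC (dip (nth (x0, true) w))) (iota 0 (size w).+1) = (cost w).+1.
Proof.
rewrite /= add1n; congr _.+1.
rewrite (iotaDl 1 0) count_map; elim: w => //= a w IHw.
rewrite (iotaDl 1 0) count_map -IHw; congr (~~ (_ && _) + _)%N.
by case: w {IHw}.
Qed.

Lemma cost_push a w : (cost (push a w) <= (cost w).+1)%N.
Proof.
case: w => [|b w] /=; first by case: (a.2).
by case: ifP => _ /=; [lia | case: (_ && ~~ _); lia].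
Qed.

(** If the inverse of [y] stays, [x] is free in front of it; if it cancels, only [x] can add to the
    cost. *)
Lemma cost_push_pos_neg x y w :
  x != y -> (cost (push (x, true) (push (y, false) w)) <= (cost w).+1)%N.
Proof.
move=> neq_xy; have {1}-> : push (y, false) w =
    if w is (z, true) :: w' then if z == y then w' else (y, false) :: w
    else (y, false) :: w.
  by case: w => [|[z []] w] //=; rewrite xpair_eqE ?andbF ?andbT.
have push_yF v : cost (push (x, true) ((y, false) :: v)) = (cost v).+1.
  by rewrite /= xpair_eqE eq_sym (negPf neq_xy).
case: w => [|[z []] w]; rewrite ?push_yF //.
case: ifP => _; last by rewrite push_yF.
by case: w => [|[z' []] w] //=; case: ifP => _ //=; lia.
Qed.

(** * Reduced words assembled from syllables *)

Lemma val_prod_letters w : reduced w ->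
  val (\prod_(a <- w) free_letter (@free_gen X) a)%g = w.
Proof.
elim: w => [|a w IHw] rw; first by rewrite big_nil.
rewrite big_cons -[RHS](push_cons rw) -[in RHS](IHw (path_sorted rw)).
by case: a {rw} => x [].
Qed.

Lemma reduced_nseq n a v :
  reduced v -> (if v is b :: _ then b.1 != a.1 else true) ->
  reduced (nseq n a ++ v).
Proof.
move=> rv nx; elim: n => //= n IHn; case: n IHn => [_|n IHn] /=.
  by case: v rv nx => //= b v -> nx; rewrite andbT; apply: contraNneq nx => ->.
rewrite [path _ _ _]IHn andbT; case: a {nx IHn} => x [];
  by rewrite xpair_eqE eqxx.
Qed.

Lemma cost_nseq n a v :
  cost (nseq n.+1 a ++ v) = (n + (~~ (a.2 && starts_neg v) + cost v))%N.
Proof. by elim: n => //= n ->; rewrite andbN addSn add1n. Qed.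

Fixpoint syllables m (i : nat -> X) (alpha : nat -> int) : seq (letter X) :=
  if m isn't m'.+1 then [::] else
  nseq `|alpha 0%N|%N ((i 0%N, 0 < alpha 0%N) : letter X) ++
  syllables m' (fun j => i j.+1) (fun j => alpha j.+1).

Lemma prod_syllables m i (alpha : nat -> int) :
  (\prod_(a <- syllables m i alpha) free_letter (@free_gen X) a =
   \prod_(j < m) expgz (free_gen (i j)) (alpha j))%g.
Proof.
elim: m i alpha => [|m IHm] i alpha /=; first by rewrite big_nil big_ord0.
rewrite big_cat big_ord_recl IHm; congr (_ * _)%g.
have prod_nseq n (a : letter X) : (\prod_(b <- nseq n a)
    free_letter (@free_gen X) b = free_letter (@free_gen X) a ^+ n)%g.
  by elim: n => [|n IHn] /=; rewrite ?big_nil // big_cons IHn expgS.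
rewrite prod_nseq /free_letter; case: (alpha 0%N) => -[|n] //=.
by rewrite expVgn.
Qed.

Lemma reduced_syllables m i (alpha : nat -> int) :
  (forall j, (j.+1 < m)%N -> i j != i j.+1) ->
  (forall j, (j < m)%N -> alpha j != 0) -> reduced (syllables m i alpha).
Proof.
elim: m i alpha => [|m IHm] i alpha hi ha //=; apply: reduced_nseq.
  by apply: IHm => j lt_jm; [exact: (hi j.+1) | exact: (ha j.+1)].
case: m hi ha {IHm} => [|m] hi ha //=.
case: (alpha 1%N) (ha 1%N isT) => -[|n] //= _; by rewrite eq_sym hi.
Qed.

(** A syllable has letters of one sign, so dips occur only between syllables. The guard on [j.+1]
    keeps [alpha m] out of the count. *)
Lemma cost_syllables m i (alpha : nat -> int) :
  (forall j, (j < m)%N -> alpha j != 0) ->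
  (cost (syllables m i alpha) +
    \sum_(0 <= j < m) [&& j.+1 < m, (0 < alpha j)%R & (alpha j.+1 < 0)%R] =
    \sum_(0 <= j < m) `|alpha j|)%N.
Proof.
elim: m i alpha => [|m IHm] i alpha ha; first by rewrite !big_nil.
rewrite !big_nat_recl //= -(IHm (fun j => i j.+1) (fun j => alpha j.+1)).
  2: by move=> j; exact: (ha j.+1).
have := ha 0%N isT; rewrite -absz_gt0; case: `|_|%N => // n _.
rewrite cost_nseq /=.
have -> : starts_neg (syllables m (fun j => i j.+1) (fun j => alpha j.+1)) =
    (1 < m.+1)%N && (alpha 1%N < 0).
  case: m ha {IHm} => //= m /(_ 1%N isT).
  by case: (alpha 1%N) => -[|p].
rewrite -!(andbCA (0 < alpha 0%N)).
by case: (_ && _); rewrite !add0n !add1n !(addnS, addSn) addnA.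
Qed.

End WordCost.

(** * The cost is the word length *)

Section WordLength.
Set Implicit Arguments.
Unset Strict Implicit.
Unset Printing Implicit Defensive.
Context {k : nat}.
Local Open Scope group_scope.

(** Left multiplication by a generator raises the cost by at most one; this is the lower bound on
    word length. *)
Lemma cost_generated (s : seq (freegroup 'I_k)) :
  (forall x, x \in s -> generating_set k x) ->
  (cost (val (\prod_(x <- s) x)%g) <= size s)%N.
Proof.
elim: s => [_|x s IHs sE]; first by rewrite big_nil.
have {}IHs : (cost (val (\prod_(y <- s) y)%g) <= size s)%N.
  by apply: IHs => y sy; apply: sE; rewrite inE sy orbT.
rewrite big_cons; set h := (\prod_(y <- s) y)%g in IHs *.
suff le_xh : (cost (val (x * h)%g) <= (cost (val h)).+1)%N.
  by apply: leq_trans le_xh _; rewrite ltnS.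
have := sE x (mem_head _ _).
case=> [[i ->]|[[i ->]|[i [j [neq_ij ->]]]]].
- exact: cost_push.
- exact: (cost_push (i, false)).
- by rewrite -mulgA; exact: cost_push_pos_neg neq_ij.
Qed.

(** The two letters at a dip merge into one generator, their indices being distinct by reducedness;
    other letters are used singly. *)
Lemma cost_attained (w : seq (letter 'I_k)) : reduced w ->
  exists s : seq (freegroup 'I_k),
    [/\ forall x, x \in s -> generating_set k x,
        \prod_(x <- s) x = \prod_(a <- w) free_letter (@free_gen _) a &
        size s = cost w].
Proof.
(* Induction on the length, since a merge consumes two letters. *)
have [n] := ubnP (size w); elim: n => // n IHn in w *.
have cons_gen x v s : generating_set k x ->
    (forall y, y \in s -> generating_set k y) ->
    \prod_(y <- s) y = \prod_(a <- v) free_letter (@free_gen _) a ->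
    [/\ forall y, y \in x :: s -> generating_set k y,
      \prod_(y <- x :: s) y = x * \prod_(a <- v) free_letter (@free_gen _) a &
      size (x :: s) = (size s).+1].
  move=> Ex Es sv; split=> // [y|]; last by rewrite big_cons sv.
  by rewrite inE => /predU1P[->|/Es].
case: w => [_ _|a w]; first by exists [::]; rewrite !big_nil.
rewrite [size _]/= ltnS => lt_wn rw.
have [/andP[a2 w_neg]|nneg] := boolP (a.2 && starts_neg w).
  case: w lt_wn w_neg rw => // b w lt_wn b2 rw.
  have rw' : reduced w by case/andP: rw => _ /path_sorted.
  have [s [Es sw sz]] := IHn w (ltnW lt_wn) rw'.
  have Eab : generating_set k (free_gen a.1 / free_gen b.1).
    right; right; exists a.1, b.1; split=> //.
    have /andP[neq_ba _] := rw; apply: contraNneq neq_ba.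
    by case: a b a2 b2 {lt_wn rw} => x [] [y []] //= _ _ ->.
  have [Es' ss' _] := cons_gen _ _ _ Eab Es sw.
  exists ((free_gen a.1 / free_gen b.1) :: s); split=> //.
    rewrite ss' !big_cons mulgA; congr (_ * _).
    by rewrite /free_letter a2 (negbTE b2).
  by rewrite /= a2 (negbTE b2) sz.
have [s [Es sw sz]] := IHn w lt_wn (path_sorted rw).
have Ea : generating_set k (free_letter (@free_gen _) a).
  by case: a {rw nneg} => x []; [left | right; left]; exists x.
have [Es' ss' _] := cons_gen _ _ _ Ea Es sw.
exists (free_letter (@free_gen _) a :: s); split=> //.
  by rewrite ss' big_cons.
by rewrite /= nneg sz.
Qed.

Lemma is_word_length_cost (g : freegroup 'I_k) :
  is_word_length (generating_set k) g (cost (val g)).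
Proof.
split=> [|s sE <-]; last exact: cost_generated.
have [s [sE sg sz]] := cost_attained (valP g); exists s; split=> //.
by rewrite sg; apply: val_inj; exact: val_prod_letters (valP g).
Qed.

End WordLength.

(** By uniqueness of the lift, [mu g] is the full prefix product of [g]. The default letter at [x0]
    is positive, as the endpoint requires, and the [- 1] in [norm] cancels the extra unit of
    [count_dip]. *)
Lemma norm_free_hom (K : fieldType) (X : finType) (x0 : X)
    (mu : {multiplicative freegroup X -> srat K X}) :
  (forall x, val (mu (free_gen x)) = 1 + seriesX K x) ->
  forall g, norm (mu g) = (cost (val g))%:Z.
Proof.
move=> hmu g; pose f x := mu (free_gen x).
pose a := nth (x0, true) (val g).
have muE : val (mu g) = magnus_prefix a (size (val g)).
  rewrite (@free_lift_unique _ _ f mu) // /magnus_prefix.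
  rewrite -(big_mkord xpredT (magnus \o a)).
  rewrite -(big_nth _ xpredT magnus) /free_lift.
  elim: (val g) => [|b w IHw]; first by rewrite !big_nil.
  rewrite !big_cons -IHw; congr (_ * _).
  by case: b => x []; rewrite /free_letter /magnus /= /f hmu.
have red : reduced_upto a (size (val g)).
  by exact: (elimT (sortedP (x0, true)) (valP g)).
rewrite /norm muE rho_closure_constants_prefix //; last by rewrite /a nth_default.
rewrite (dimE (has_dim_prefix_span red)) count_dip.
by rewrite -addn1 PoszD addrK.
Qed.

Theorem theorem8p3 (K : fieldType) (k : nat) (hk : (1 <= k)%N)
    (mu : {multiplicative freegroup 'I_k -> srat K 'I_k})
    (hmu : forall j : 'I_k, val (mu (free_gen j)) = 1 + seriesX K j)
    (m : nat) (i : nat -> 'I_k) (alpha : nat -> int)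
    (hi : forall j : nat, (j.+1 < m)%N -> i j != i j.+1)
    (halpha : forall j : nat, (j < m)%N -> alpha j != 0)
    (g : freegroup 'I_k)
    (hg : g = (\prod_(j < m) expgz (free_gen (i j)) (alpha j))%g) :
  let c := #|[set j : 'I_m | [&& (j.+1 < m)%N, 0 < alpha j & alpha j.+1 < 0]]| in
  norm (mu g) = - c%:Z + \sum_(j < m) `|alpha j| /\
  exists2 n : nat, is_word_length (generating_set k) g n & norm (mu g) = n%:Z.
Proof.
(* Being reduced, the word of syllables is the normal form stored in [g]. *)
pose r := reduced_syllables hi halpha.
have {hg} gE : g = exist (@reduced _) _ r.
  by rewrite hg -prod_syllables; apply: val_inj; exact: val_prod_letters.
have mu_g := norm_free_hom (i 0%N) hmu g.
move=> c; split; last first.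
  by exists (cost (val g)) => //; exact: is_word_length_cost.
have cE : c = (\sum_(0 <= j < m)
    [&& j.+1 < m, (0 < alpha j)%R & (alpha j.+1 < 0)%R])%N.
  by rewrite /c cardsE -sum1_card big_mkcond big_mkord.
have := cost_syllables i halpha; rewrite -cE big_mkord.
rewrite mu_g gE [val _]/= => /(congr1 Posz); rewrite PoszD => costE.
by rewrite addrC -[LHS](addrK c%:Z) costE -natz natr_sum; congr (_ - _);
  apply: eq_bigr => j _; rewrite natz abszE.
Qed.
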